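(* Every nested sequence of open intervals in ${}^*\mathbb{R}$ has a non-empty intersection. That is, if $\alpha_n,\beta_n\in{}^*\mathbb{R}$ ($n\in\mathbb{N}$) satisfy $\alpha_n<\beta_n$ and $\alpha_n\le\alpha_{n+1}<\beta_{n+1}\le\beta_n$ for all $n\in\mathbb{N}$, then $\bigcap_{n\in\mathbb{N}}(\alpha_n,\beta_n)\neq\varnothing$.
   Context: $\mathbb{R}_+$ is the set of positive real numbers and $\mathbb{N}=\{1,2,3,\dots\}$. Fix an ultrafilter $\mathcal{U}$ on $\mathbb{R}_+$ such that $(0,\tfrac1n)\in\mathcal{U}$ for all $n\in\mathbb{N}$. A property of $\varepsilon\in\mathbb{R}_+$ holds almost everywhere (a.e.) if the set of $\varepsilon$ for which it holds belongs to $\mathcal{U}$. For nets $(a_\varepsilon),(b_\varepsilon)\in\mathbb{C}^{\mathbb{R}_+}$ write $(a_\varepsilon)\sim(b_\varepsilon)$ if $a_\varepsilon=b_\varepsilon$ a.e.; $\langle a_\varepsilon\rangle$ is the equivalence class, and ${}^*\mathbb{C}=\mathbb{C}^{\mathbb{R}_+}/\!\sim$. ${}^*\mathbb{R}=\{\langle a_\varepsilon\rangle : a_\varepsilon\in\mathbb{R}\text{ a.e.}\}$, ordered by $\langle a_\varepsilon\rangle<\langle b_\varepsilon\rangle$ iff $a_\varepsilon<b_\varepsilon$ a.e. For $\alpha<\beta$ in ${}^*\mathbb{R}$, $(\alpha,\beta)=\{x\in{}^*\mathbb{R}:\alpha<x<\beta\}$. *)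

(* Defs.v *)
From HB Require Import structures.
From mathcomp Require Import all_boot all_order all_algebra.
From mathcomp Require Import all_classical all_reals all_analysis.
From mathcomp Require Import generic_quotient complex.

Set Implicit Arguments.
Unset Strict Implicit.
Unset Printing Implicit Defensive.

Import Order.TTheory GRing.Theory Num.Theory.
Local Open Scope classical_set_scope.
Local Open Scope quotient_scope.
Local Open Scope ring_scope.

(* The index set of positive reals is {posnum R}; "P holds a.e." is
   [\forall e \near U, P e], which unfolds to [U [set e | P e]]. *)
Section StarNumbers.
Variables (R : realType) (U : set_system {posnum R}) (UU : UltraFilter U).

Definition cnet : Type := {posnum R} -> R[i].
HB.instance Definition _ := Choice.copy cnet ({posnum R} -> R[i]).

Definition ae_eq_net (a b : cnet) : bool := `[< \forall e \near U, a e = b e >].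

Lemma ae_eq_net_refl : reflexive ae_eq_net.
Proof. by move=> a; apply/asboolP; apply: filterE. Qed.

Lemma ae_eq_net_sym : symmetric ae_eq_net.
Proof.
by move=> a b; apply/asboolP/asboolP => h; apply: filterS h => e ->.
Qed.

Lemma ae_eq_net_trans : transitive ae_eq_net.
Proof.
move=> b a c /asboolP ab /asboolP bc; apply/asboolP.
by apply: filterS2 ab bc => e -> ->.
Qed.

Canonical ae_eq_net_equiv :=
  EquivRel ae_eq_net ae_eq_net_refl ae_eq_net_sym ae_eq_net_trans.

Definition star_complex : Type := {eq_quot ae_eq_net_equiv}.
HB.instance Definition _ := Choice.on star_complex.
HB.instance Definition _ := EqQuotient.on star_complex.

Definition is_star_real (x : star_complex) : bool :=
  `[< exists2 a : cnet,
        \forall e \near U, a e \is Num.real & x = \pi_star_complex a >].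

Record star_real : Type := StarReal {
  star_real_val :> star_complex;
  _ : is_star_real star_real_val }.

HB.instance Definition _ := [isSub for star_real_val].
HB.instance Definition _ := [Choice of star_real by <:].

(* On R[i], x < y means that x and y have the same imaginary part and that
   their real parts are strictly ordered; on real numbers this is the usual
   order.  The choice of representatives is irrelevant: see star_ltE. *)
Definition star_lt (x y : star_real) : bool :=
  `[< \forall e \near U,
        repr (star_real_val x) e < repr (star_real_val y) e >].

Lemma star_lt_irr : irreflexive star_lt.
Proof.
move=> x; apply/asboolP => h; apply: (filter_not_empty U).
by apply: filterS h => e; rewrite ltxx.
Qed.

Lemma star_lt_trans : transitive star_lt.
Proof.
move=> y x z /asboolP xy /asboolP yz; apply/asboolP.
by apply: filterS2 xy yz => e; exact: lt_trans.
Qed.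

Fact star_display : Order.disp_t. Proof. exact: Order.Disp tt tt. Qed.

(* The associated weak order is x = y \/ x < y. *)
HB.instance Definition _ :=
  Order.Lt_isPOrder.Build star_display star_real star_lt_irr star_lt_trans.

Lemma repr_starE (a : cnet) (x : star_complex) :
  x = \pi_star_complex a -> \forall e \near U, repr x e = a e.
Proof.
move=> ->; have : repr (\pi_star_complex a) = a %[mod star_complex].
  by rewrite reprK.
by move/eqquotP/asboolP.
Qed.

Lemma star_ltE (x y : star_real) (a b : cnet) :
    star_real_val x = \pi_star_complex a ->
    star_real_val y = \pi_star_complex b ->
  (x < y)%O <-> \forall e \near U, a e < b e.
Proof.
move=> /repr_starE xa /repr_starE yb.
split=> [/asboolP h|h]; last apply/asboolP;
  by apply: filterS3 xa yb h => e -> ->.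
Qed.

Lemma star_real_reprP (x : star_real) :
  \forall e \near U, repr (star_real_val x) e \is Num.real.
Proof.
case: x => x /= /asboolP[a ar /repr_starE xa].
by apply: filterS2 ar xa => e ? ->.
Qed.

Lemma star_le_total : total (<=%O : rel star_real).
Proof.
move=> x y.
have [h|h] := in_ultra_setVsetC
  [set e | repr (star_real_val x) e < repr (star_real_val y) e] UU.
  by rewrite ltW//; apply/asboolP.
have [h'|h'] := in_ultra_setVsetC
  [set e | repr (star_real_val y) e < repr (star_real_val x) e] UU.
  by rewrite (@ltW _ _ y) ?orbT//; apply/asboolP.
suff -> : x = y by rewrite lexx.
apply/val_inj => /=.
suff h2 : \forall e \near U,
    repr (star_real_val x) e = repr (star_real_val y) e.
  by rewrite -[LHS]reprK -[RHS]reprK; apply/eqquotP/asboolP.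
have H : U [set e | (repr (star_real_val x) e \is Num.real) &&
                    (repr (star_real_val y) e \is Num.real)].
  by apply: filterS2 (star_real_reprP x) (star_real_reprP y) => e /= -> ->.
apply: filterS3 H h h' => e /= /andP[xr yr] /negP xy /negP yx.
by apply/le_anti; rewrite !real_leNgt ?xy ?yx.
Qed.

HB.instance Definition _ :=
  Order.POrder_isTotal.Build star_display star_real star_le_total.

End StarNumbers.

(* Main.v *)
(** Countable saturation by diagonalisation. On representatives, let H n be the
    set of e < 1/n at which the first n intervals are nested and the n-th one
    is nonempty; it belongs to U. Each e > 0 lies in only finitely many H n, so
    take for x(e) the midpoint of the interval whose index is the largest n
    with e in H n. *)
Require Import Defs.
From mathcomp Require Import all_boot all_order all_algebra.
From mathcomp Require Import all_classical all_reals all_analysis.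
From mathcomp Require Import generic_quotient complex.

Import Order.TTheory GRing.Theory Num.Theory.
Local Open Scope classical_set_scope.
Local Open Scope ring_scope.

Lemma star_le_repr {R : realType} {U : set_system {posnum R}}
    {UU : UltraFilter U} {x y : star_real UU} :
  (x <= y)%O ->
  \forall e \near U, repr (star_real_val x) e <= repr (star_real_val y) e.
Proof.
rewrite le_eqVlt => /orP[/eqP -> | /asboolP xy]; first exact: filterE.
by apply: filterS xy => e /ltW.
Qed.

Lemma le_from1 {d : Order.disp_t} {T : porderType d} (u : nat -> T) :
  (forall n, (0 < n)%N -> (u n <= u n.+1)%O) ->
  forall i n, (0 < i)%N -> (i <= n)%N -> (u i <= u n)%O.
Proof.
move=> u_le i n i_gt0; elim: n => [|n IHn]; first by rewrite leqNgt i_gt0.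
rewrite leq_eqVlt => /predU1P[-> //|]; rewrite ltnS => i_le_n.
by rewrite (le_trans (IHn i_le_n))// u_le// (leq_trans i_gt0).
Qed.

(** A filter is closed under finite intersections only, so the bound [n] is essential: it lets [i]
    range over the finite type ['I_n.+1]. *)
Lemma near_forall_leq {T : Type} (F : set_system T) (FF : Filter F)
    (P : nat -> T -> Prop) n :
  (forall i, (0 < i)%N -> (i <= n)%N -> \forall e \near F, P i e) ->
  \forall e \near F, forall i, (0 < i)%N -> (i <= n)%N -> P i e.
Proof.
move=> FP.
have : \forall e \near F, forall i : 'I_n.+1, (0 < i)%N -> P i e.
  apply: filter_forall => -[i i_le_n] /=.
  have [->|i_gt0] := posnP i; first exact: filterE.
  by apply: filterS (FP i i_gt0 i_le_n) => e.
apply: filterS => e Pe i i_gt0 i_le_n.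
exact: (Pe (Ordinal (i_le_n : (i < n.+1)%N))).
Qed.

(** The Archimedean property applied to 1/e. It guarantees that a largest index exists in the
    diagonal choice. *)
Lemma inv_nat_gt_bounded {R : realType} (e : {posnum R}) :
  exists m, forall n : nat, (0 < n)%N -> e%:num < n%:R^-1 -> (n <= m)%N.
Proof.
exists (Num.bound e%:num^-1) => n n_gt0 e_lt.
have n_lt : n%:R < e%:num^-1 by rewrite -[n%:R]invrK ltf_pV2 ?posrE ?invr_gt0 ?ltr0n.
rewrite -(ler_nat R) ltW// (lt_le_trans n_lt)// ltW//.
by apply: archi_boundP.
Qed.

Theorem theorem2p10p5 (R : realType) (U : set_system {posnum R})
    (UU : UltraFilter U)
    (U_small : forall n : nat, (0 < n)%N ->
      U [set e : {posnum R} | e%:num < n%:R^-1])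
    (alpha beta : nat -> star_real UU)
    (alpha_lt_beta : forall n : nat, (0 < n)%N -> (alpha n < beta n)%O)
    (nested : forall n : nat, (0 < n)%N ->
      [/\ (alpha n <= alpha n.+1)%O, (alpha n.+1 < beta n.+1)%O &
          (beta n.+1 <= beta n)%O]) :
  \bigcap_(n in [set n : nat | (0 < n)%N]) `]alpha n, beta n[%classic !=set0.
Proof.
pose a n : cnet R := repr (star_real_val (alpha n)).
pose b n : cnet R := repr (star_real_val (beta n)).
(* Realness of the endpoints is recorded because the midpoint must be real too, and < on [R[i]] only
   forces equal imaginary parts. *)
pose H n (e : {posnum R}) := [/\ (0 < n)%N, e%:num < n%:R^-1,
  (a n e \is Num.real) /\ (b n e \is Num.real), a n e < b n e &
  forall i, (0 < i)%N -> (i <= n)%N -> a i e <= a n e /\ b n e <= b i e].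
have U_H n : (0 < n)%N -> \forall e \near U, H n e.
  move=> n_gt0; have /asboolP ab := alpha_lt_beta n n_gt0.
  have reals : \forall e \near U, (a n e \is Num.real) /\ (b n e \is Num.real).
    by apply: filterS2 (star_real_reprP (alpha n)) (star_real_reprP (beta n)).
  have nest : \forall e \near U, forall i, (0 < i)%N -> (i <= n)%N ->
      a i e <= a n e /\ b n e <= b i e.
    apply: near_forall_leq => i i_gt0 i_le_n.
    have le_a : (alpha i <= alpha n)%O.
      by apply: le_from1 i_gt0 i_le_n => k /nested[].
    have le_b : (beta n <= beta i)%O.
      (* A decreasing sequence is increasing for the dual order. *)
      by apply: (@le_from1 _ (star_real UU)^d beta) i_gt0 i_le_n => k /nested[].
    by apply: filterS2 (star_le_repr le_a) (star_le_repr le_b).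
  have small_ab : \forall e \near U, e%:num < n%:R^-1 /\ a n e < b n e.
    by apply: filterS2 (U_small n n_gt0) ab.
  by apply: filterS3 small_ab reals nest => e [].
(* For each [e], a single [z] has to serve every [n] with [H n e], so that the resulting net does
   not depend on [n]. *)
have /choice[x xP] (e : {posnum R}) : exists z : R[i],
    forall n, H n e -> [/\ z \is Num.real, a n e < z & z < b n e].
  have [[n0 Hn0]|noH] := pselect (exists n, H n e); last first.
    (* The condition is vacuous here, so 0 is an arbitrary default. *)
    by exists 0 => n Hn; case: noH; exists n.
  have [m mP] := inv_nat_gt_bounded e.
  have exH : exists n, `[< H n e >] by exists n0; apply/asboolP.
  have bndH n : `[< H n e >] -> (n <= m)%N.
    by move=> /asboolP[n_gt0 + _ _ _]; exact: mP.
  case: (ex_maxnP exH bndH) => N /asboolP[_ _ [ar br] ab nest] Nmax.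
  exists ((a N e + b N e) / 2) => n Hn.
  have [n_gt0 _ _ _ _] := Hn.
  (* Since n <= N, the nesting stored in [H N e] puts the N-th interval inside the n-th. *)
  have [le_a le_b] := nest n n_gt0 (Nmax n (asboolT Hn)).
  have [lt_a lt_b] := midf_lt ab.
  split; last 2 first.
  - exact: le_lt_trans le_a lt_a.
  - exact: lt_le_trans lt_b le_b.
  - by rewrite rpredM// ?rpredD// rpredV realn.
have x_real : is_star_real (\pi_(star_complex UU) (x : cnet R))%qT.
  apply/asboolP; exists x => //.
  (* Any positive index would do. *)
  by apply: filterS (U_H 1%N isT) => e /xP[].
have reprE (y : star_real UU) :
    star_real_val y = (\pi_(star_complex UU) (repr (star_real_val y)))%qT.
  by rewrite reprK.
exists (StarReal x_real) => n n_gt0 /=.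
rewrite in_itv /=; apply/andP; split.
(* The new point is compared through the net [x] itself, not through the [repr] of its class, so
   [xP] applies on [H n]. *)
- apply/(star_ltE (reprE _) (erefl : star_real_val (StarReal x_real) = _)).
  by apply: filterS (U_H n n_gt0) => e /xP[].
- apply/(star_ltE (erefl : star_real_val (StarReal x_real) = _) (reprE _)).
  by apply: filterS (U_H n n_gt0) => e /xP[].
Qed.
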